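(* Let $k$ be a field of characteristic $p>0$ and $G$ a finite group of order divisible by $p$. Then every $R\in\mathfrak{Ts}_G$ is generated as a $k$-algebra by its points, i.e. by the elements $r\in R$ with $\mathrm{tr}_G(r)=1$.
   Context: $\mathfrak{Ts}_G$ is the category of finitely generated commutative $k$-algebras $R$ on which $G$ acts by $k$-algebra automorphisms such that the trace map $\mathrm{tr}_G: R\to R^G$, $r\mapsto\sum_{g\in G} rg$, is surjective onto the ring of invariants $R^G$. A point of $R\in\mathfrak{Ts}_G$ is an element $r\in R$ with $\mathrm{tr}_G(r)=1$. *)

(* Defs.v *)
From HB Require Import structures.
From mathcomp Require Import all_boot all_order all_fingroup all_algebra.

Set Implicit Arguments.
Unset Strict Implicit.
Unset Printing Implicit Defensive.

Import GRing.Theory.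
Local Open Scope ring_scope.

(* A commutative k-algebra is a commutative ring R with a structure morphism
   iota : k -> R. This is used instead of comAlgType k because the latter
   excludes the zero ring, which is a commutative k-algebra. *)

(* The k-subalgebra of R generated by X, i.e. the smallest subset of R that
   contains X and is closed under the k-algebra operations. Subtraction is
   covered, since - a = iota (- 1) * a. *)
Inductive gen_subalg (k : fieldType) (R : comPzRingType)
    (iota : {rmorphism k -> R}) (X : R -> Prop) : R -> Prop :=
  | gen_subalg_in r : X r -> gen_subalg iota X r
  | gen_subalg_scalar c : gen_subalg iota X (iota c)
  | gen_subalg_add a b :
      gen_subalg iota X a -> gen_subalg iota X b -> gen_subalg iota X (a + b)
  | gen_subalg_mul a b :
      gen_subalg iota X a -> gen_subalg iota X b -> gen_subalg iota X (a * b).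

Definition generated_by (k : fieldType) (R : comPzRingType)
    (iota : {rmorphism k -> R}) (X : R -> Prop) : Prop :=
  forall r : R, gen_subalg iota X r.

Definition finitely_generated (k : fieldType) (R : comPzRingType)
    (iota : {rmorphism k -> R}) : Prop :=
  exists s : seq R, generated_by iota (fun r => r \in s).

Definition alg_automorphism (k : fieldType) (R : comPzRingType)
    (iota : {rmorphism k -> R}) (f : R -> R) : Prop :=
  [/\ bijective f, zmod_morphism f, monoid_morphism f
    & forall c : k, f (iota c) = iota c].

(* {action G &-> R} is a right action: to r g stands for r g. *)
Definition invariant_elt (G : finGroupType) (R : comPzRingType)
    (to : {action G &-> R}) (r : R) : Prop :=
  forall g : G, to r g = r.

Definition trace (G : finGroupType) (R : comPzRingType)
    (to : {action G &-> R}) (r : R) : R :=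
  \sum_(g : G) to r g.

(* Surjectivity onto the invariants does not ask that traces be invariant,
   since they always are when G acts by automorphisms. *)
Definition in_Ts (k : fieldType) (G : finGroupType) (R : comPzRingType)
    (iota : {rmorphism k -> R}) (to : {action G &-> R}) : Prop :=
  [/\ finitely_generated iota,
      forall g : G, alg_automorphism iota (fun r => to r g)
    & forall a : R, invariant_elt to a -> exists r : R, trace to r = a].

Definition point (G : finGroupType) (R : comPzRingType)
    (to : {action G &-> R}) (r : R) : Prop :=
  trace to r = 1.

(* Main.v *)
Require Import Defs.
From HB Require Import structures.
From mathcomp Require Import all_boot all_order all_fingroup all_algebra.

Import GRing.Theory.
Local Open Scope ring_scope.

(* Fix a point w. If tr r = 0, then w + r is a point, so the subalgebra S
   generated by the points contains the kernel of the trace. Since p divides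
   |G|, every invariant a has trace |G| a = 0, so S contains R^G. Finally, for
   any r, tr (r - (tr r) w) = 0, so that r lies in S. *)

Lemma gen_subalg_sub {k : fieldType} {R : comPzRingType}
    {iota : {rmorphism k -> R}} {X : R -> Prop} {a b : R} :
  gen_subalg iota X a -> gen_subalg iota X b -> gen_subalg iota X (a - b).
Proof.
move=> Sa Sb; apply: gen_subalg_add => //.
rewrite -mulN1r -(rmorphN1 iota).
by apply: gen_subalg_mul => //; apply: gen_subalg_scalar.
Qed.

(* MathComp's actM only covers actions on finite types. *)
Lemma act_mul {G : finGroupType} {T : Type} (to : {action G &-> T})
    (x : T) (g h : G) : to x (g * h)%g = to (to x g) h.
Proof. by case: to => f [_ fM] /=; apply: fM; rewrite inE. Qed.

Section Trace.

Context {k : fieldType} {G : finGroupType} {R : comPzRingType}.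
Context {iota : {rmorphism k -> R}} {to : {action G &-> R}}.
Hypothesis toA : forall g : G, alg_automorphism iota (fun r => to r g).

Lemma traceB : {morph trace to : r s / r - s}.
Proof.
move=> r s; rewrite /trace -sumrB; apply: eq_bigr => g _.
by have [_ toB _ _] := toA g; rewrite toB.
Qed.

Lemma trace_invariantMl {a : R} (r : R) :
  invariant_elt to a -> trace to (a * r) = a * trace to r.
Proof.
move=> inv_a; rewrite /trace mulr_sumr; apply: eq_bigr => g _.
by have [_ _ [_ toM] _] := toA g; rewrite toM inv_a.
Qed.

(** Right multiplication by [h] permutes [G], so acting by [h] only reorders the summands. *)
Lemma trace_invariant (r : R) : invariant_elt to (trace to r).
Proof.
move=> h; have [_ toB _ _] := toA h.
(* Bundling the action of [h] as an additive map lets it pass through the sum. *)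
pose f : {additive R -> R} :=
  HB.pack (fun r => to r h) (GRing.isZmodMorphism.Build R R _ toB).
rewrite -[LHS]/(f _) /trace raddf_sum [RHS](reindex_inj (mulIg h)) /=.
by apply: eq_bigr => g _; rewrite act_mul.
Qed.

End Trace.

Lemma trace_of_invariant {G : finGroupType} {R : comPzRingType}
    {to : {action G &-> R}} {a : R} :
  invariant_elt to a -> trace to a = a *+ #|G|.
Proof. by move=> inv_a; rewrite /trace (eq_bigr (fun=> a)) ?sumr_const. Qed.

Theorem corollary2p8 (k : fieldType) (p : nat) (char_k : p \in [pchar k])
    (G : finGroupType) (dvd_p_G : (p %| #|G|)%N)
    (R : comPzRingType) (iota : {rmorphism k -> R}) (to : {action G &-> R}) :
  in_Ts iota to -> generated_by iota (point to).
Proof.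
case=> _ toA tr_surj r.
have inv1 : invariant_elt to 1 by move=> g; have [_ _ [to1 _] _] := toA g.
have [w tr_w] := tr_surj 1 inv1.
have Sw : gen_subalg iota (point to) w by apply: gen_subalg_in.
have Sker s : trace to s = 0 -> gen_subalg iota (point to) s.
  (* Write [s = w - (w - s)], a difference of two points. *)
  move=> tr_s; rewrite -(subKr w s); apply: gen_subalg_sub => //.
  by apply: gen_subalg_in; rewrite /point (traceB toA) tr_w tr_s subr0.
have inv_tr := trace_invariant toA r.
(* The first summand, [r - trace to r * w], has trace zero because [trace to r] is invariant and
   comes out of the trace. *)
rewrite -(subrK (trace to r * w) r); apply: gen_subalg_add.
  by apply: Sker; rewrite (traceB toA) (trace_invariantMl toA) // tr_w mulr1 subrr.
apply: gen_subalg_mul => //; apply: Sker.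
(* The characteristic is known for [k], so the factor [#|G|] is pulled back along [iota] and
   vanishes there. *)
rewrite (trace_of_invariant inv_tr) -mulr_natr -(rmorph_nat iota).
by move: dvd_p_G; rewrite (dvdn_pcharf char_k) => /eqP ->; rewrite rmorph0 mulr0.
Qed.
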